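(* Let $\bm{\mu}\in X^{\mathcal{L}(\mathcal{T})}$ be the true vector of leaf means and assume $V_{s_0}(\bm{\mu})\neq\theta$. Consider any algorithm that uses the GLR stopping rule $\tau_\delta=\inf\{t\in\mathbb{N}:Z_{s_0}(t)\ge\beta(t,\delta)\}$ and any sampling rule which ensures that, for every leaf $\ell\in\mathcal{L}(\mathcal{T})$, $N_\ell(t)/t\to w^{s_0}_\ell(\bm{\mu})$ almost surely as $t\to\infty$. Then for all $\delta\in(0,1)$, $\mathbb{P}(\tau_\delta<+\infty)=1$, and \[\mathbb{P}_{\bm{\mu}}\Big(\limsup_{\delta\to 0}\frac{\tau_\delta}{\log(1/\delta)}\le\frac{1}{d_{s_0}(\bm{\mu})}\Big)=1.\]
   Context: Tree: finite rooted tree $\mathcal{T}$, node set $S$, root $s_0$, children $\mathcal{C}(s)$, leaves $\mathcal{L}(\mathcal{T})$, $\mathcal{D}(s)$ leaves descending from $s$; internal labels $L(s)\in\{\text{MAX},\text{MIN}\}$. $X\subseteq\mathbb{R}$ mean-parameter set of a one-parameter exponential family; $d(x,y)$ the KL divergence between members with means $x,y$; threshold $\theta\in X$. $V_s(\bm{\lambda})=\lambda_s$ at leaves, max/min of children's values at MAX/MIN nodes; $a_s(\bm{\lambda})=$'win' iff $V_s(\bm{\lambda})\ge\theta$. Recursive weights at $\bm{\mu}$: $a^*=a_{s_0}(\bm{\mu})$; $P=$MAX, $Q=$MIN if $a^*=$'win', swapped if 'lose'. Leaf $s$: $w^s_s=1$, $d_s=d(\mu_s,\theta)$ if ($a^*=$'win',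 $\mu_s\ge\theta$) or ($a^*=$'lose', $\mu_s<\theta$), else $0$. $L(s)=P$: $d_s=\max_c d_c$, fix $c^*(s)\in\arg\max_c d_c$, if $d_s>0$ then $w^s_\ell=w^{c^*(s)}_\ell$ on $\mathcal{D}(c^*(s))$ and $0$ on the other children's leaves. $L(s)=Q$, all $d_c>0$: $d_s=(\sum_c 1/d_c)^{-1}$, $w^s_\ell=\frac{w^c_\ell/d_c}{\sum_{c'}1/d_{c'}}$ for $\ell\in\mathcal{D}(c)$. $L(s)=Q$ otherwise: $d_s=0$. Internal $s$ with $d_s=0$: $\bm{w}^s$ an arbitrary probability vector on $\mathcal{D}(s)$. Sampling model: at each round $t$ a leaf $I(t)$ is chosen and an independent reward drawn from its distribution (mean $\mu_{I(t)}$); $N_\ell(t)$ counts, $\hat\mu_\ell(t)$ empirical means. $Z_{s_0}(t)=\inf_{\bm{\lambda}\in X^{\mathcal{L}(\mathcal{T})}:a_{s_0}(\bm{\lambda})\neq a_{s_0}(\hat{\bm{\mu}}(t))}\sum_\ell N_\ell(t)d(\hat\mu_\ell(t),\lambda_\ell)$. Threshold: $h(x)=x-\ln x$, $h^{-1}:[1,\infty)\to[1,\infty)$ its inverse on $[1,\infty)$; $\tilde h(x)=e^{1/h^{-1}(x)}h^{-1}(x)$ if $x\ge h(1/\ln(3/2))$, else $\frac32(x-\ln\ln\frac32)$; $\mathcal{C}_{\exp}(x)=2\tilde h\big(\frac{h^{-1}(1+x)+\ln(\pi^2/3)}{2}\big)$; $\beta(t,\delta)=3\sum_\ell\log(1+\log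 N_\ell(t))+|\mathcal{L}(\mathcal{T})|\mathcal{C}_{\exp}\big(\frac{\log(1/\delta)}{|\mathcal{L}(\mathcal{T})|}\big)$. *)

(* Defs.v *)
From mathcomp Require Import all_boot all_order all_algebra.
From mathcomp Require Import all_classical all_reals all_analysis.
Set Implicit Arguments.
Unset Strict Implicit.
Unset Printing Implicit Defensive.
Import Order.TTheory GRing.Theory Num.Theory numFieldNormedType.Exports.
Local Open Scope classical_set_scope.
Local Open Scope ring_scope.

Section ExpFamily.
Context {R : realType}.
Implicit Types (rho : {measure set R -> \bar R}).

Definition partition_fun rho (eta : R) : \bar R :=
  (\int[rho]_y (expR (eta * y))%:E)%E.

Definition natparam_set rho : set R :=
  [set eta | (partition_fun rho eta < +oo)%E].

Definition logpart rho (eta : R) : R := ln (fine (partition_fun rho eta)).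

Definition fam_density rho (eta y : R) : R := expR (eta * y - logpart rho eta).

Definition fam_law rho (eta : R) (A : set R) : \bar R :=
  (\int[rho]_(y in A) (fam_density rho eta y)%:E)%E.

Definition fam_mean rho (eta : R) : \bar R :=
  (\int[rho]_y (y * fam_density rho eta y)%:E)%E.

Definition meanset rho : set R :=
  [set x | exists2 eta, (natparam_set rho)° eta & fam_mean rho eta = x%:E].

Definition nat_of_mean rho (x : R) : R :=
  xget 0 [set eta | (natparam_set rho)° eta /\ fam_mean rho eta = x%:E].

Definition KL_nat rho (a b : R) : \bar R :=
  (\int[rho]_y (fam_density rho a y *
                ln (fam_density rho a y / fam_density rho b y))%:E)%E.

(* d(x,y): KL divergence between the members with means x and y.
   For x outside X (this can only happen for an empirical mean) we use the
   standard lower-semicontinuous (Chernoff / convex-conjugate) extension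
   sup_{eta in Theta} [(eta - eta_y) x - b(eta) + b(eta_y)], which coincides
   with the KL divergence on X. *)
Definition kl rho (x y : R) : \bar R :=
  if `[< meanset rho x >] then KL_nat rho (nat_of_mean rho x) (nat_of_mean rho y)
  else ereal_sup [set ((eta - nat_of_mean rho y) * x - logpart rho eta
                        + logpart rho (nat_of_mean rho y))%:E
                 | eta in natparam_set rho].

End ExpFamily.

(* Finite rooted MAX/MIN trees.  An internal node carries its label         *)
(* (true = MAX, false = MIN) and its nonempty list of children c :: cs.     *)
(* Leaves carry a name (a nat); the leaf set L(T) is [leaves T].            *)

Inductive tree := Leaf of nat | Node of bool & tree & seq tree.

Fixpoint leaves (t : tree) : seq nat :=
  match t with
  | Leaf i => [:: i]
  | Node _ c cs => leaves c ++ flatten (map leaves cs)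
  end.

Section TreeValues.
Context {R : realType}.

Fixpoint value (lam : nat -> R) (t : tree) : R :=
  match t with
  | Leaf i => lam i
  | Node b c cs =>
      if b then foldr Num.max (value lam c) (map (value lam) cs)
      else foldr Num.min (value lam c) (map (value lam) cs)
  end.

Definition win (theta : R) (lam : nat -> R) (t : tree) : bool :=
  theta <= value lam t.

Variables (rho : {measure set R -> \bar R}) (theta : R) (mu : nat -> R).

(* d_s(mu); astar = a_{s0}(mu) (true = win).  A node is of type P iff its
   label is MAX and astar = win, or its label is MIN and astar = lose,
   i.e. iff (label == astar). *)
Fixpoint dval (astar : bool) (t : tree) : R :=
  match t with
  | Leaf i =>
      if (astar && (theta <= mu i)) || (~~ astar && (mu i < theta))
      then fine (kl rho (mu i) theta) else 0
  | Node b c cs =>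
      if b == astar then foldr Num.max (dval astar c) (map (dval astar) cs)
      else if all (fun x => 0 < x) (dval astar c :: map (dval astar) cs)
           then (\sum_(x <- dval astar c :: map (dval astar) cs) x^-1)^-1
           else 0
  end.

(* [wrel astar w t] : w (restricted to the leaves of t) is an admissible
   value of the recursive weight vector w^t(mu), for some choice of the
   argmax children c*(s) and of the arbitrary probability vectors used at
   internal nodes with d_s = 0. *)
Fixpoint wrel (astar : bool) (w : nat -> R) (t : tree) {struct t} : Prop :=
  match t with
  | Leaf i => w i = 1
  | Node b c cs =>
      if 0 < dval astar t then
        if b == astar then
          foldr or False
            (map (fun c' => dval astar c' = dval astar t /\
                   exists wc, wrel astar wc c' /\
                     forall l, l \in leaves t ->
                       w l = if l \in leaves c' then wc l else 0)
                 (c :: cs))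
        else
          foldr and True
            (map (fun c' => exists wc, wrel astar wc c' /\
                   forall l, l \in leaves c' ->
                     w l = (wc l / dval astar c') /
                           (\sum_(c'' <- c :: cs) (dval astar c'')^-1))
                 (c :: cs))
      else
        (forall l, l \in leaves t -> 0 <= w l) /\ \sum_(l <- leaves t) w l = 1
  end.

End TreeValues.

(* Threshold beta(t, delta).  (ln x = 0 for x <= 0, MathComp convention.)   *)

Section Threshold.
Context {R : realType}.

Definition hfun (x : R) : R := x - ln x.

Definition hinv (x : R) : R := xget 1 [set y | 1 <= y /\ hfun y = x].

Definition htilde (x : R) : R :=
  if hfun (1 / ln (3 / 2)) <= x then expR (1 / hinv x) * hinv x
  else 3 / 2 * (x - ln (ln (3 / 2))).

Definition Cexp (x : R) : R :=
  2 * htilde ((hinv (1 + x) + ln (pi ^+ 2 / 3)) / 2).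

End Threshold.

(* Sampling model (reward-table model): Y l k is the k-th reward (k = 0,1,..)*)
(* obtained from leaf l; I t is the leaf sampled at round t (t = 1,2,...).  *)

Section Sampling.
Context {R : realType} {d : measure_display} {Omega : measurableType d}.

Definition mutually_independent (P : probability Omega R) {I : eqType}
    (J : set I) (Z : I -> Omega -> R) : Prop :=
  forall (s : seq I), uniq s -> (forall i, i \in s -> J i) ->
  forall (A : I -> set R), (forall i, measurable (A i)) ->
    P (\bigcap_(i in [set` s]) (Z i @^-1` A i)) =
    (\prod_(i <- s) P (Z i @^-1` A i))%E.

Definition Npulls (I : nat -> Omega -> nat) (l t : nat) (om : Omega) : nat :=
  count (fun s => I s om == l) (iota 1 t).

Definition emp_mean (Y : nat -> nat -> Omega -> R) (I : nat -> Omega -> nat)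
    (l t : nat) (om : Omega) : R :=
  let n := Npulls I l t om in
  if n == 0%N then 0 else (\sum_(k < n) Y l k om) / n%:R.

Variables (rho : {measure set R -> \bar R}) (theta : R) (tr : tree).

Definition glr_stat (Y : nat -> nat -> Omega -> R) (I : nat -> Omega -> nat)
    (t : nat) (om : Omega) : \bar R :=
  ereal_inf
    [set (\sum_(l <- leaves tr)
            (Npulls I l t om)%:R%:E * kl rho (emp_mean Y I l t om) (lam l))%E
    | lam in [set lam : nat -> R |
               (forall l, l \in leaves tr -> meanset rho (lam l)) /\
               win theta lam tr != win theta (fun l => emp_mean Y I l t om) tr]].

Definition beta_thr (I : nat -> Omega -> nat) (t : nat) (om : Omega)
    (delta : R) : R :=
  3 * (\sum_(l <- leaves tr) ln (1 + ln (Npulls I l t om)%:R))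
  + (size (leaves tr))%:R * Cexp (ln (1 / delta) / (size (leaves tr))%:R).

Definition stop_time (Y : nat -> nat -> Omega -> R) (I : nat -> Omega -> nat)
    (delta : R) (om : Omega) : \bar R :=
  ereal_inf [set (t%:R)%:E | t in
             [set t : nat | ((beta_thr I t om delta)%:E <= glr_stat Y I t om)%E]].

End Sampling.

(* Main.v *)
(** On the leaves selected by the recursive weights (the best child at P-nodes,
    all children at Q-nodes) the product [w l * d(mu l, theta)] is constant and
    equal to [d_{s0}]; these leaves form a strategy that decides the outcome of
    the tree by itself, so every alternative [lam] has to move one of them
    across [theta].  Hence [Z(t) >= min_l N_l(t) d(muhat_l(t), theta)] over
    these leaves, and the right-hand side grows like [d_{s0} t] once the
    empirical means converge.  Leaves of weight zero play no role, although
    their empirical means need not converge.  Divergences enter only through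
    the affine minorants [x |-> (eta - eta_y) x - b eta + b eta_y] of [d(x, y)],
    which are valid for every real [x]; no continuity of [d] is needed.  The
    law of large numbers follows from a Chernoff bound and Borel-Cantelli, the
    moment generating functions being finite near [0].  Finally
    [beta(t, delta) <= k t + (1 + k) log(1/delta) + C_k] for every [k > 0]. *)
Require Import Defs.
From Stdlib Require List.
From mathcomp Require Import all_boot all_order all_algebra.
From mathcomp Require Import all_classical all_reals all_analysis.
From mathcomp Require Import measurable_realfun ring lra.
Import Order.TTheory GRing.Theory Num.Theory numFieldNormedType.Exports.
Local Open Scope classical_set_scope.
Local Open Scope ring_scope.
Set Implicit Arguments.
Unset Strict Implicit.
Unset Printing Implicit Defensive.

(** * Winning strategies and the recursive weights *)

Lemma tree_seq_ind (Q : tree -> Prop) :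
  (forall i, Q (Leaf i)) ->
  (forall b c cs, (forall c', List.In c' (c :: cs) -> Q c') -> Q (Node b c cs)) ->
  forall t, Q t.
Proof.
move=> QL QN; fix IH 1 => -[i|b c cs]; first exact: QL.
apply: QN => c' [<-|]; first exact: (IH c).
elim: cs => [[]|c1 cs IHcs [<-|c'cs]]; [exact: (IH c1)|exact: (IHcs c'cs)].
Qed.

Section Strategies.
Context {R : realType}.
Implicit Types (theta : R) (lam mu w : nat -> R) (a b : bool) (t c : tree).

Lemma hasP_In T (p : pred T) (s : seq T) :
  has p s <-> exists2 x, List.In x s & p x.
Proof.
elim: s => [|x s IH] /=; first by split=> // -[].
split=> [/orP[px|/IH[y ys py]]|[y [<- ->//|ys] py]].
- by exists x => //; left.
- by exists y => //; right.
- by apply/orP; right; apply/IH; exists y.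
Qed.

Lemma allP_In T (p : pred T) (s : seq T) :
  all p s <-> forall x, List.In x s -> p x.
Proof.
elim: s => [|x s IH] /=; first by split.
split=> [/andP[px /IH ps] y [<-//|]|ps]; first exact: ps.
by rewrite ps ?IH; [move=> y ys; apply: ps; right|left].
Qed.

Lemma lt_foldr_max (x y : R) (s : seq R) :
  (x < foldr Num.max y s) = has (fun z => x < z) (y :: s).
Proof.
elim: s => [|z s IH] /=; first by rewrite orbF.
by rewrite lt_max IH /= orbCA.
Qed.

Lemma lt_foldr_min (x y : R) (s : seq R) :
  (x < foldr Num.min y s) = all (fun z => x < z) (y :: s).
Proof.
elim: s => [|z s IH] /=; first by rewrite andbT.
by rewrite lt_min IH /= andbCA.
Qed.

Lemma le_foldr_max (x y : R) (s : seq R) :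
  (x <= foldr Num.max y s) = has (fun z => x <= z) (y :: s).
Proof.
elim: s => [|z s IH] /=; first by rewrite orbF.
by rewrite le_max IH /= orbCA.
Qed.

Lemma le_foldr_min (x y : R) (s : seq R) :
  (x <= foldr Num.min y s) = all (fun z => x <= z) (y :: s).
Proof.
elim: s => [|z s IH] /=; first by rewrite andbT.
by rewrite le_min IH /= andbCA.
Qed.

Lemma win_node theta lam b c cs :
  win theta lam (Node b c cs) =
  if b then has (win theta lam) (c :: cs) else all (win theta lam) (c :: cs).
Proof.
by case: b; rewrite /win /= ?le_foldr_max ?le_foldr_min /= ?has_map ?all_map.
Qed.

Lemma win_has theta lam a c cs :
  has (fun c' => win theta lam c' == a) (c :: cs) ->
  win theta lam (Node a c cs) = a.
Proof.
rewrite win_node; case: a => /hasP_In[c' c'cs /eqP Wc'].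
  by apply/hasP_In; exists c' => //; rewrite Wc'.
by apply/negP => /allP_In/(_ c' c'cs); rewrite Wc'.
Qed.

Lemma win_all theta lam a c cs :
  all (fun c' => win theta lam c' == a) (c :: cs) ->
  win theta lam (Node (~~ a) c cs) = a.
Proof.
rewrite win_node; case: a => /(allP_In _ (c :: cs)) W.
  by apply/(allP_In _ (c :: cs)) => c' c'cs; rewrite (eqP (W _ c'cs)).
by apply/negP => /(hasP_In _ (c :: cs))[c' c'cs]; rewrite (eqP (W _ c'cs)).
Qed.

Definition strict_win theta lam a t :=
  if a then theta < value lam t else value lam t < theta.

Lemma strict_win_node theta lam a b c cs :
  strict_win theta lam a (Node b c cs) ->
  if b == a then has (strict_win theta lam a) (c :: cs)
  else all (strict_win theta lam a) (c :: cs).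
Proof.
case: a; case: b; rewrite /strict_win /=.
- by rewrite lt_foldr_max /= has_map.
- by rewrite lt_foldr_min /= all_map.
- rewrite ltNge le_foldr_max -all_predC /= all_map ltNge.
  by move=> /andP[-> /=]; apply: sub_all => x /=; rewrite ltNge.
- rewrite ltNge le_foldr_min -has_predC /= has_map ltNge.
  move=> /orP[->//|H]; apply/orP; right; move: H.
  by apply: sub_has => x /=; rewrite ltNge.
Qed.

Variables (rho : {measure set R -> \bar R}) (theta : R) (mu : nat -> R).

Definition on_side a (i : nat) :=
  (a && (theta <= mu i)) || (~~ a && (mu i < theta)).

Lemma leaves_child b c cs c' : List.In c' (c :: cs) ->
  {subset leaves c' <= leaves (Node b c cs)}.
Proof.
move=> c'cs l lc' /=.
case: c'cs lc' => [<-|c'cs] lc'; rewrite mem_cat ?lc'//.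
apply/orP; right; elim: cs c'cs => //= c1 cs IHcs [->|/IHcs lcs].
  by rewrite mem_cat lc'.
by rewrite mem_cat lcs orbT.
Qed.

Lemma dval_gt0 a t :
  (forall l, l \in leaves t -> mu l != theta ->
     0 < fine (kl rho (mu l) theta)) ->
  strict_win theta mu a t -> 0 < dval rho theta mu a t.
Proof.
elim/tree_seq_ind: t => [i Hkl|b c cs IH Hkl].
  rewrite /strict_win /=; case: a => /= Hi.
    by rewrite (ltW Hi) /=; apply: Hkl; rewrite ?mem_head// gt_eqF.
  by rewrite Hi; apply: Hkl; rewrite ?mem_head// lt_eqF.
have IH' c' : List.In c' (c :: cs) -> strict_win theta mu a c' ->
    0 < dval rho theta mu a c'.
  by move=> c'cs; apply: IH => // l lc'; apply/Hkl/(leaves_child b c'cs).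
move=> /strict_win_node /=; case: ifP => _ H.
  rewrite lt_foldr_max /= has_map.
  apply/(hasP_In (fun c' => 0 < dval rho theta mu a c') (c :: cs)).
  by have /(hasP_In _ (c :: cs))[c' c'cs Hc'] := H; exists c' => //; apply: IH'.
have dpos : all (fun c' => 0 < dval rho theta mu a c') (c :: cs).
  apply/(allP_In _ (c :: cs)) => c' c'cs; apply: IH' => //.
  by move/(allP_In _ (c :: cs)): H; apply.
move: dpos => /= /andP[dc dcs]; rewrite dc all_map dcs /=.
rewrite invr_gt0 big_cons ltr_pwDl ?invr_gt0// big_map.
elim: cs dcs {IH Hkl IH' H} => [|c1 cs IHcs] /=; first by rewrite big_nil.
by move=> /andP[d1 /IHcs ds]; rewrite big_cons addr_ge0// invr_ge0 ltW.
Qed.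

Lemma foldr_orP T (p : T -> Prop) (s : seq T) :
  foldr or False (map p s) -> exists2 x, List.In x s & p x.
Proof.
elim: s => //= x s IH [px|/IH[y ys py]]; first by exists x => //; left.
by exists y => //; right.
Qed.

Lemma foldr_andP T (p : T -> Prop) (s : seq T) :
  foldr and True (map p s) -> forall x, List.In x s -> p x.
Proof. by elim: s => //= x s IH [px /IH ps] y [<-//|]; apply: ps. Qed.

(* The leaves of [s] form a winning strategy for player [a], and the recursive
   weights equalise [w l * d(mu l, theta)] over them. *)
Definition balanced_strategy a w t (s : seq nat) :=
  (forall l, l \in s -> [/\ l \in leaves t, 0 < w l, on_side a l,
     0 < fine (kl rho (mu l) theta) &
     w l * fine (kl rho (mu l) theta) = dval rho theta mu a t]) /\
  (forall lam, (forall l, l \in s -> (theta <= lam l) = a) ->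
     win theta lam t = a).

Lemma wrel_strategy a w t : wrel rho theta mu a w t ->
  0 < dval rho theta mu a t -> exists s, balanced_strategy a w t s.
Proof.
elim/tree_seq_ind: t w => [i|b c cs IH] w.
  move=> /= wi d0; have {}d0 : on_side a i /\ 0 < fine (kl rho (mu i) theta).
    by rewrite /on_side; move: d0; case: ifP => //; rewrite ltxx.
  case: d0 => si d0; exists [:: i]; split=> [l|lam].
    rewrite inE => /eqP ->; split=> //; first by rewrite wi.
    by rewrite wi mul1r /= -/(on_side a i) si.
  by apply; rewrite mem_head.
move=> W d0; move: W.
rewrite [wrel _ _ _ _ _ _]/= -/(dval rho theta mu a (Node b c cs)) d0.
case: (eqVneq b a) => [ba|ba].
  move=> /(foldr_orP (s := c :: cs))[c' c'cs [dc' [wc [Wc' ww]]]].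
  have dc'0 : 0 < dval rho theta mu a c' by rewrite dc'.
  have [s [sP sW]] := IH _ c'cs _ Wc' dc'0; exists s; split=> [l ls|lam Hlam].
    have [ls' wl sl dl wd] := sP _ ls.
    have lt := leaves_child b c'cs ls'.
    rewrite (ww _ lt) ls'; split=> //.
    by rewrite wd.
  rewrite ba; apply: win_has; apply/hasP_In; exists c' => //.
  by apply/eqP/sW.
move=> /(foldr_andP (s := c :: cs)) H.
have dE : dval rho theta mu a (Node b c cs) =
    (\sum_(c'' <- c :: cs) (dval rho theta mu a c'')^-1)^-1 /\
    forall c', List.In c' (c :: cs) -> 0 < dval rho theta mu a c'.
  move: d0 => /=; rewrite (negbTE ba); case: ifP; last by rewrite ltxx.
  move=> /andP[dc dcs] _; split; first by rewrite !big_cons big_map.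
  apply/(allP_In (fun c' => 0 < dval rho theta mu a c') (c :: cs)).
  by rewrite /= dc; rewrite all_map in dcs.
have [dE1 dc0] := dE.
have S0 : 0 < \sum_(c'' <- c :: cs) (dval rho theta mu a c'')^-1.
  by move: d0; rewrite dE1 invr_gt0.
have Hs c' : List.In c' (c :: cs) -> exists s : seq nat,
  (forall l, l \in s -> [/\ l \in leaves (Node b c cs), 0 < w l, on_side a l,
     0 < fine (kl rho (mu l) theta) &
     w l * fine (kl rho (mu l) theta) = dval rho theta mu a (Node b c cs)]) /\
  (forall lam, (forall l, l \in s -> (theta <= lam l) = a) ->
     win theta lam c' = a).
  move=> c'cs; have [wc [Wc' ww]] := H _ c'cs.
  have [s [sP sW]] := IH _ c'cs _ Wc' (dc0 _ c'cs).
  exists s; split=> // l ls; have [ls' wl sl dl wd] := sP _ ls.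
  have dc := dc0 _ c'cs.
  split=> //; first exact: (leaves_child b c'cs).
    by rewrite ww// !divr_gt0.
  by rewrite ww// dE1 mulrAC (mulrAC (wc l)) wd divff ?gt_eqF// mul1r.
have {}Hs : exists s : seq nat, (forall l, l \in s ->
  [/\ l \in leaves (Node b c cs), 0 < w l, on_side a l,
     0 < fine (kl rho (mu l) theta) &
     w l * fine (kl rho (mu l) theta) = dval rho theta mu a (Node b c cs)]) /\
  (forall lam, (forall l, l \in s -> (theta <= lam l) = a) ->
     forall c', List.In c' (c :: cs) -> win theta lam c' = a).
  move: Hs; move: (Node b c cs) (c :: cs) => t.
  elim=> [_|c1 cs1 IHc Hs]; first by exists [::].
  have [|s1 [s1P s1W]] := Hs c1; first by left.
  have [|s2 [s2P s2W]] := IHc; first by move=> c' H'; apply: Hs; right.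
  exists (s1 ++ s2); split=> [l|lam Hlam c' /= [<-|c'cs]].
  - by rewrite mem_cat => /orP[/s1P|/s2P].
  - by apply: s1W => l ls; apply: Hlam; rewrite mem_cat ls.
  - by apply: s2W => // l ls; apply: Hlam; rewrite mem_cat ls orbT.
have [s [sP sW]] := Hs; exists s; split=> // lam Hlam.
have -> : b = ~~ a by move: ba; clear; case: b; case: a.
by apply: win_all; apply/(allP_In _ (c :: cs)) => c' c'cs; apply/eqP/sW.
Qed.

End Strategies.

(** * Linear bounds on the threshold *)

Section ThresholdBounds.
Context {R : realType}.
Implicit Types (k x y z : R).

Lemma ln_le_linear k : 0 < k -> exists2 C, 0 <= C &
  forall z, 1 <= z -> ln z <= k * z + C.
Proof.
move=> k0; exists `|ln k| => // z z1.
have z0 : 0 < z by rewrite (lt_le_trans _ z1).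
have := @le_ln1Dx R (k * z - 1).
rewrite addrCA subrr addr0 lnM ?posrE//.
have kz : 0 < k * z by rewrite mulr_gt0.
have := ler_norm (- ln k); rewrite normrN.
have -> : -1 < k * z - 1 by lra.
by move=> h1 /(_ isT); lra.
Qed.

(* [hinv] defaults to 1 off the range of [hfun]; the bounds below hold for this
   default too, so the surjectivity of [hfun] is never needed. *)
Lemma hinv_ge1 x : 1 <= hinv x.
Proof. by rewrite /hinv; case: xgetP => // y _ []. Qed.

Lemma hinv_le k : 0 < k -> exists2 C, 0 <= C &
  forall x, 0 <= x -> hinv x <= (1 + k) * x + C.
Proof.
move=> k0; have k'0 : 0 < k / (1 + k) by rewrite divr_gt0//; lra.
have [C C0 HC] := ln_le_linear k'0.
exists (1 + (1 + k) * C) => [|x x0]; first by rewrite addr_ge0// mulr_ge0//; lra.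
have kx : 0 <= (1 + k) * x by rewrite mulr_ge0//; lra.
have kC : 0 <= (1 + k) * C by rewrite mulr_ge0//; lra.
rewrite /hinv; case: xgetP => [y _ [y1]|_]; last by lra.
rewrite /hfun => yx; have := HC _ y1.
have -> : ln y = y - x by lra.
rewrite -(ler_pM2l (_ : 0 < 1 + k)); last by lra.
have -> : (1 + k) * (k / (1 + k) * y + C) = k * y + (1 + k) * C.
  rewrite mulrDr mulrA (mulrC (1 + k)) mulfVK//.
  by apply/eqP; lra.
by lra.
Qed.

Lemma expRV_le z : 1 <= z -> expR (1 / z) * z <= z + expR 1.
Proof.
move=> z1; have z0 : 0 < z by lra.
have zV : 1 / z <= 1 by rewrite div1r invf_le1.
have e1 : expR (1 / z) <= expR 1 by rewrite ler_expR.
have uz : 1 / z * z = 1 by rewrite mulfVK ?gt_eqF.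
move: (1 / z) e1 uz => u e1 uz.
have h : (1 - u) * expR u <= 1.
  have := expR_ge1Dx (- u); rewrite expRN => h.
  by rewrite -ler_pdivlMr ?expR_gt0// div1r.
have := ler_wpM2r (ltW z0) h; rewrite mul1r.
have -> : (1 - u) * expR u * z = expR u * z - expR u * (u * z) by ring.
by rewrite uz; lra.
Qed.

Lemma htilde_le k : 0 < k -> exists2 C, 0 <= C &
  forall x, 0 <= x -> htilde x <= (1 + k) * x + C.
Proof.
move=> k0; have [C C0 HC] := hinv_le k0.
pose H : R := hfun (1 / ln (3 / 2)); pose c : R := ln (ln (3 / 2)).
exists (C + expR 1 + 3 / 2 * (`|H| + `|c|)) => [|x x0].
  by rewrite !addr_ge0// ?expR_ge0// mulr_ge0// ?addr_ge0//; lra.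
have kx : 0 <= (1 + k) * x by rewrite mulr_ge0//; lra.
have e0 := expR_ge0 (1 : R).
have h0 := normr_ge0 H; have c0 := normr_ge0 c.
have h1 := ler_norm H; have c1 := ler_norm (- c).
rewrite normrN in c1.
rewrite /htilde -/H -/c; case: ifPn => [_|]; last by rewrite -ltNge; lra.
have := expRV_le (hinv_ge1 x); have := HC _ x0; lra.
Qed.

Lemma Cexp_le k : 0 < k -> exists2 C, 0 <= C &
  forall x, 0 <= x -> Cexp x <= (1 + k) * x + C.
Proof.
move=> k0; have [k1 k10 k1k] : exists2 k1 : R, 0 < k1 & (1 + k1) * (1 + k1) <= 1 + k.
  have [k1|k1] := leP k 1; [exists (k / 3); nra|exists (1 / 3); nra].
have [C1 C10 H1] := hinv_le k10; have [C2 C20 H2] := htilde_le k10.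
pose c : R := ln (pi ^+ 2 / 3).
have c0 : 0 <= c.
  by apply: ln_ge0; have := @pi_ge2 R; nra.
exists (2 * C2 + (1 + k1) * (c + C1 + 1 + k1)) => [|x x0].
  by rewrite addr_ge0// mulr_ge0//; lra.
rewrite /Cexp -/c.
have h1 := hinv_ge1 (1 + x).
have := H2 ((hinv (1 + x) + c) / 2).
have := H1 (1 + x).
have -> : 0 <= 1 + x by lra.
have -> : 0 <= (hinv (1 + x) + c) / 2 by lra.
move=> /(_ isT) A /(_ isT) B.
nra.
Qed.

Context {d : measure_display} {Omega : measurableType d}.

Lemma Npulls_le (I : nat -> Omega -> nat) l t om : (Npulls I l t om <= t)%N.
Proof. by rewrite /Npulls (leq_trans (count_size _ _))// size_iota. Qed.

Lemma loglog_le k : 0 < k -> exists2 C, 0 <= C &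
  forall n t : nat, (n <= t)%N -> ln (1 + ln n%:R : R) <= k * t%:R + C.
Proof.
move=> k0; have [C C0 HC] := ln_le_linear k0; exists C => // n t nt.
case: n nt => [|n] nt; first by
  rewrite (@ln0 _ 0%:R)// addr0 ln1 addr_ge0// mulr_ge0// ltW.
have n1 : 1 <= n.+1%:R :> R by rewrite ler1n.
have n0 : 0 < n.+1%:R :> R by rewrite ltr0n.
have l1 := le_ln1Dx (x := n.+1%:R - 1 : R).
have ln_ge := ln_ge0 n1.
have : ln n.+1%:R <= n.+1%:R - 1 :> R.
  by move: l1; rewrite addrCA subrr addr0; apply; lra.
move=> h; have : ln (1 + ln n.+1%:R) <= ln n.+1%:R :> R.
  by rewrite ler_ln ?posrE//; lra.
move=> /le_trans; apply; apply: (le_trans (HC _ n1)).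
by rewrite lerD2r ler_pM2l// ler_nat.
Qed.

Lemma beta_thr_le (tr : tree) (I : nat -> Omega -> nat) k : 0 < k ->
  exists2 C, 0 <= C & forall t om delta, 0 < delta < 1 ->
  beta_thr tr I t om delta <= k * t%:R + (1 + k) * ln (1 / delta) + C.
Proof.
move=> k0; set n : R := (size (leaves tr))%:R.
have n1 : 1 <= n.
  rewrite /n ler1n; have : leaves tr != [::].
    elim/tree_ind: {n} tr => [//|b c IH cs] /=; move: IH.
    by case: (leaves c).
  by case: (leaves tr).
have n0 : 0 < n by lra.
have [C1 C10 H1] := loglog_le (divr_gt0 k0 (mulr_gt0 (ltr0Sn R 2) n0)).
have [C2 C20 H2] := Cexp_le k0.
exists (3 * n * C1 + n * C2) => [|t om delta /andP[d0 d1]].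
  by rewrite addr_ge0// !mulr_ge0//; lra.
have L0 : 0 <= ln (1 / delta) by rewrite div1r lnV ?posrE// oppr_ge0 ln_le0// ltW.
rewrite /beta_thr -/n.
have S : \sum_(l <- leaves tr) ln (1 + ln (Npulls I l t om)%:R) <= k / 3 * t%:R + n * C1.
  apply: (@le_trans _ _ (\sum_(l <- leaves tr) (k / (3 * n) * t%:R + C1))).
    by apply: ler_sum => l _; exact/H1/Npulls_le.
  rewrite big_const_seq count_predT iter_addr_0 -[_ *+ _]mulr_natl -/n mulrDr.
  by rewrite lerD2r; rewrite le_eqVlt; apply/orP; left; apply/eqP; field; rewrite gt_eqF.
have := H2 (ln (1 / delta) / n) (divr_ge0 L0 (ltW n0)).
rewrite -(ler_pM2l n0).
have -> : n * ((1 + k) * (ln (1 / delta) / n) + C2) = (1 + k) * ln (1 / delta) + n * C2.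
  by rewrite mulrDr mulrCA (mulrCA n) mulfV ?mulr1//; apply/eqP; lra.
lra.
Qed.

End ThresholdBounds.

(** * Exponential families *)

Lemma fin_integral_integrable d (T : measurableType d) (R : realType)
    (m : {measure set T -> \bar R}) (f : T -> \bar R) (r : R) :
  measurable_fun [set: T] f -> (\int[m]_x f x = r%:E)%E -> m.-integrable setT f.
Proof.
move=> mf; rewrite integralE => fr; apply/integrableP; split=> //.
have mp := measurable_funepos mf; have mn := measurable_funeneg mf.
have -> : (fun x => `|f x|)%E = (fun x => f^\+%E x + f^\-%E x)%E.
  by rewrite -[LHS]/(abse \o f) fune_abse.
have fp0 : (0 <= \int[m]_x f^\+%E x)%E by apply: integral_ge0.
have fn0 : (0 <= \int[m]_x f^\-%E x)%E by apply: integral_ge0.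
rewrite ge0_integralD//; move: fr fp0 fn0.
by case: (integral _ _ _) => [p| |]; case: (integral _ _ _) => [q| |]//=;
  rewrite ltry.
Qed.

Section ExpFamilyFacts.
Context {R : realType}.
Variable rho : {measure set R -> \bar R}.
Hypothesis rho0 : rho setT != 0%E.
Implicit Types (eta s x y : R) (g : R -> R).

Local Notation b := (logpart rho).
Local Notation f := (fam_density rho).

Definition has_expect eta g (r : R) :=
  rho.-integrable setT (fun y => (g y * f eta y)%:E) /\
  (\int[rho]_y (g y * f eta y)%:E = r%:E)%E.

Lemma measurable_density eta : measurable_fun setT (f eta).
Proof.
apply: measurableT_comp => //; apply: measurable_funB => //.
Qed.

Lemma has_expectI eta g r : measurable_fun setT g ->
  (\int[rho]_y (g y * f eta y)%:E = r%:E)%E -> has_expect eta g r.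
Proof.
move=> mg E; split=> //; apply: (fin_integral_integrable (r := r)) => //.
by apply/measurable_EFinP/measurable_funM => //; exact: measurable_density.
Qed.

Lemma has_expectD eta g1 g2 r1 r2 : has_expect eta g1 r1 ->
  has_expect eta g2 r2 -> has_expect eta (fun y => g1 y + g2 y) (r1 + r2).
Proof.
move=> [i1 e1] [i2 e2]; rewrite /has_expect.
have -> : (fun y => ((g1 y + g2 y) * f eta y)%:E) =
  (fun y => (g1 y * f eta y)%:E + (g2 y * f eta y)%:E)%E.
  by apply/funext => y; rewrite mulrDl EFinD.
by split; [exact: integrableD|rewrite integralD// e1 e2].
Qed.

Lemma has_expectZ eta g c r : has_expect eta g r ->
  has_expect eta (fun y => c * g y) (c * r).
Proof.
move=> [i1 e1]; rewrite /has_expect.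
have -> : (fun y => (c * g y * f eta y)%:E) =
  (fun y => c%:E * (g y * f eta y)%:E)%E.
  by apply/funext => y; rewrite -mulrA EFinM.
by split; [exact: integrableZl|rewrite integralZl// e1].
Qed.

Lemma has_expect_le eta g1 g2 r1 r2 : (forall y, g1 y <= g2 y) ->
  has_expect eta g1 r1 -> has_expect eta g2 r2 -> r1 <= r2.
Proof.
move=> g12 [i1 e1] [i2 e2]; rewrite -lee_fin -e1 -e2.
apply: le_integral => // y _.
by rewrite lee_fin ler_wpM2r// expR_ge0.
Qed.

Lemma partition_fun_gt0 eta : (0 < partition_fun rho eta)%E.
Proof.
rewrite lt0e integral_ge0 ?andbT; last by move=> y _; rewrite lee_fin expR_ge0.
apply: contra_neq rho0 => I0.
have mf : measurable_fun setT (fun y => (expR (eta * y))%:E).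
  by apply/measurable_EFinP; apply: measurableT_comp => //; exact: measurable_funM.
have : (\int[rho]_y `|(expR (eta * y))%:E| = 0)%E.
  by rewrite -[RHS]I0; apply: eq_integral => y _; rewrite gee0_abs// lee_fin expR_ge0.
move=> /(ae_eq_integral_abs rho measurableT mf)[N [mN N0 sN]].
apply/eqP; rewrite -measure_le0 -N0 le_measure ?inE//.
move=> y _; apply: sN => /= /(_ I) /eqP.
by rewrite eqe gt_eqF// expR_gt0.
Qed.

Lemma expR_logpart eta : natparam_set rho eta ->
  (expR (b eta))%:E = partition_fun rho eta.
Proof.
move=> H; have p0 := partition_fun_gt0 eta.
have pf : partition_fun rho eta \is a fin_num by rewrite ge0_fin_numE// ltW.
by rewrite /logpart lnK ?fineK// posrE fine_gt0// p0.
Qed.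

Lemma has_expect_expR eta s : natparam_set rho (eta + s) ->
  has_expect eta (fun y => expR (s * y)) (expR (b (eta + s) - b eta)).
Proof.
move=> H; apply: has_expectI.
  by apply: measurableT_comp => //; exact: measurable_funM.
have -> : (fun y => (expR (s * y) * f eta y)%:E) =
  (fun y => (expR (- b eta))%:E * (expR ((eta + s) * y))%:E)%E.
  apply/funext => y; rewrite -EFinM -!expRD; congr (expR _)%:E; ring.
rewrite integralZl//.
  by rewrite -/(partition_fun rho (eta + s)) -expR_logpart// -EFinM -expRD addrC.
apply: (fin_integral_integrable (r := expR (b (eta + s)))).
  by apply/measurable_EFinP; apply: measurableT_comp => //; exact: measurable_funM.
by rewrite expR_logpart.
Qed.

Lemma has_expect_cst eta c : natparam_set rho eta ->
  has_expect eta (fun=> c) c.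
Proof.
move=> H; have := @has_expect_expR eta 0; rewrite addr0 => /(_ H).
rewrite subrr expR0 => /(has_expectZ c); rewrite mulr1.
by congr has_expect; apply/funext => y; rewrite mul0r expR0 mulr1.
Qed.

Lemma has_expect_affine eta x p q : natparam_set rho eta ->
  fam_mean rho eta = x%:E -> has_expect eta (fun y => p + q * y) (p + q * x).
Proof.
move=> H Hx; apply: has_expectD; first exact: has_expect_cst.
by apply: has_expectZ; exact: has_expectI.
Qed.

Lemma logpart_tangent eta eta' x : natparam_set rho eta ->
  natparam_set rho eta' -> fam_mean rho eta = x%:E ->
  (eta' - eta) * x <= b eta' - b eta.
Proof.
move=> H H' Hx; rewrite -ler_expR.
have := @has_expect_expR eta (eta' - eta); rewrite [eta + _]addrC subrK => /(_ H').
set s := eta' - eta => hE.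
have hA := has_expect_affine (expR (s * x) * (1 - s * x)) (expR (s * x) * s) H Hx.
have := has_expect_le _ hA hE.
have -> : expR (s * x) * (1 - s * x) + expR (s * x) * s * x = expR (s * x) by ring.
apply=> y; have := expR_ge1Dx (s * y - s * x); rewrite expRB.
by rewrite ler_pdivlMr ?expR_gt0//; lra.
Qed.

Lemma expR_le_quad (u : R) : expR u <= 1 + u + u ^+ 2 * (expR u + 1).
Proof.
have h : expR u - 1 <= u * expR u.
  have := expR_ge1Dx (- u); rewrite expRN => h.
  have : (1 - u) * expR u <= 1.
    by rewrite -ler_pdivlMr ?expR_gt0// div1r.
  lra.
have e1 := expR_ge1Dx u; have e0 := expR_gt0 u.
have [u0|u0] := leP 0 u.
  have : u * (expR u - 1) <= u * (u * expR u) by rewrite ler_wpM2l.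
  have := sqr_ge0 u; nra.
have : - u * (1 - expR u) <= - u * - u by rewrite ler_wpM2l//; lra.
have : 0 <= u ^+ 2 * expR u by rewrite mulr_ge0 ?sqr_ge0// ltW.
nra.
Qed.

Lemma sqr_le_cosh (a : R) : a ^+ 2 <= 4 * (expR a + expR (- a)).
Proof.
have h (c : R) : 0 <= c -> c ^+ 2 <= 4 * expR c.
  move=> c0; have e1 := expR_ge1Dx (c / 2).
  have -> : expR c = expR (c / 2) ^+ 2 by rewrite -expRM_natr; congr expR; field.
  nra.
have := expR_gt0 a; have := expR_gt0 (- a).
have [a0|a0] := leP 0 a; first by have := h _ a0; lra.
have := h (- a); rewrite sqrrN oppr_ge0 => /(_ (ltW a0)); lra.
Qed.

Lemma expR_le_cosh (a c : R) : `|a| <= c -> expR a <= expR c + expR (- c).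
Proof.
move=> /ler_normlP[ca ac]; have := expR_gt0 (- c).
have : expR a <= expR c by rewrite ler_expR.
lra.
Qed.

Lemma expR_second_order (t s v : R) : 0 < t -> `|s| <= t ->
  expR (s * v) <= 1 + s * v +
    s ^+ 2 * (64 / t ^+ 2 * (expR (2 * t * v) + expR (- (2 * t) * v))).
Proof.
move=> t0 st; apply: (le_trans (expR_le_quad _)); rewrite lerD2l.
rewrite [leLHS](_ : _ = s ^+ 2 * (v ^+ 2 * (expR (s * v) + 1))); last by ring.
rewrite ler_wpM2l ?sqr_ge0//; set a := t * v.
have -> : expR (2 * t * v) = expR a ^+ 2.
  by rewrite -expRM_natr; congr expR; rewrite /a; ring.
have -> : expR (- (2 * t) * v) = expR (- a) ^+ 2.
  by rewrite -expRM_natr; congr expR; rewrite /a; ring.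
have sv : expR (s * v) <= expR a + expR (- a).
  have : `|s * v| <= t * `|v| by rewrite normrM ler_wpM2r.
  move=> /expR_le_cosh; rewrite /a.
  have [v0|v0] := leP 0 v; first by rewrite ger0_norm.
  by rewrite ltr0_norm // mulrN opprK addrC.
have hv := sqr_le_cosh a; have a20 := sqr_ge0 a.
have -> : v ^+ 2 = a ^+ 2 / t ^+ 2.
  by rewrite /a exprMn mulrAC mulfV ?mul1r// expf_neq0// gt_eqF.
have tV : 0 < (t ^+ 2)^-1 by rewrite invr_gt0 exprn_gt0.
have c1 : 1 <= expR a + expR (- a).
  by have := expR_ge1Dx a; have := expR_ge1Dx (- a); lra.
have ea := expR_gt0 a; have eb := expR_gt0 (- a); have esv := expR_gt0 (s * v).
have := sqr_ge0 (expR a - expR (- a)).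
move: (expR a) (expR (- a)) (expR (s * v)) (a ^+ 2) sv hv a20 c1 ea eb esv => A B C D.
move=> sv hv a20 c1 ea eb esv sq.
rewrite mulrAC [X in _ <= X](_ : _ = 64 * (A ^+ 2 + B ^+ 2) / t ^+ 2); last first.
  by field; rewrite gt_eqF.
rewrite ler_pM2r//.
have : D * (C + 1) <= (4 * (A + B)) * (2 * (A + B)).
  by apply: ler_pM => //; lra.
nra.
Qed.

Lemma mgf_subgaussian eta x : (natparam_set rho)° eta ->
  fam_mean rho eta = x%:E -> exists t K, [/\ 0 < t, 0 < K & forall s, `|s| <= t ->
    natparam_set rho (eta + s) /\ b (eta + s) - b eta <= s * x + s ^+ 2 * K].
Proof.
move=> /= Hint Hx; have H : natparam_set rho eta by exact: interior_subset Hint.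
move: Hint; rewrite /interior /= => /nbhs_ballP[e /= e0 He].
have [t t0 Ht] : exists2 t, 0 < t &
    forall s, `|s| <= 2 * t -> natparam_set rho (eta + s).
  exists (e / 4) => [|s st]; first by rewrite divr_gt0.
  apply: He; rewrite /ball /= opprD addNKr normrN.
  by apply: (le_lt_trans st); lra.
have t2 : `|2 * t| <= 2 * t by rewrite ger0_norm//; lra.
have t2' : `|- (2 * t)| <= 2 * t by rewrite normrN.
pose c1 := expR (- (2 * t * x)); pose c2 := expR (2 * t * x).
pose A := expR (b (eta + 2 * t) - b eta); pose B := expR (b (eta + - (2 * t)) - b eta).
pose K := 64 / t ^+ 2 * (c1 * A + c2 * B).
have K0 : 0 < K.
  rewrite /K mulr_gt0 ?divr_gt0 ?exprn_gt0//.
  by rewrite addr_gt0// mulr_gt0 ?expR_gt0.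
exists t, K; split=> // s st.
have Hs : natparam_set rho (eta + s) by apply: Ht; lra.
split=> //; rewrite -ler_expR.
have hA := has_expectZ c1 (has_expect_expR (Ht _ t2)).
have hB := has_expectZ c2 (has_expect_expR (Ht _ t2')).
have hC := has_expect_affine (1 - s * x) s H Hx.
have := has_expectD hC (has_expectZ (s ^+ 2 * (64 / t ^+ 2)) (has_expectD hA hB)).
move=> /(has_expectZ (expR (s * x))) hD.
apply: (le_trans (has_expect_le _ (has_expect_expR Hs) hD)).
  move=> y; have := expR_second_order (y - x) t0 st.
  have -> : s * y = s * x + s * (y - x) by ring.
  rewrite expRD ler_pM2l ?expR_gt0// => /le_trans; apply.
  rewrite /c1 /c2 -!expRD.
  rewrite (_ : - (2 * t * x) + 2 * t * y = 2 * t * (y - x)); last by ring.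
  rewrite (_ : 2 * t * x + - (2 * t) * y = - (2 * t) * (y - x)); last by ring.
  by rewrite le_eqVlt; apply/orP; left; apply/eqP; ring.
rewrite [expR (s * x + _)]expRD ler_pM2l ?expR_gt0//; apply: le_trans (expR_ge1Dx _).
by rewrite subrK -mulrA.
Qed.

(* Equality would make the tangent at [eta] of slope [x] support [b] at [eta'] as
   well, and the second-order bound at [eta'] then forces [x = x']. *)
Lemma logpart_tangent_lt eta eta' x x' : (natparam_set rho)° eta ->
  (natparam_set rho)° eta' -> fam_mean rho eta = x%:E ->
  fam_mean rho eta' = x'%:E -> x != x' ->
  (eta' - eta) * x < b eta' - b eta.
Proof.
move=> Hi Hi' Hx Hx' xx'.
have H : natparam_set rho eta by exact: interior_subset Hi.
have H' : natparam_set rho eta' by exact: interior_subset Hi'.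
rewrite lt_neqAle logpart_tangent// andbT; apply/eqP => E.
have [t [K [t0 K0 HK]]] := mgf_subgaussian Hi' Hx'.
have [c cE] : exists c, c = x - x' by exists (x - x').
have nc : 0 < `|c| by rewrite normr_gt0 cE subr_eq0.
have [h [h0 hc hhK]] : exists h, [/\ 0 < h, `|h * c| <= t & h * K <= 1 / 2].
  exists (Num.min (t / `|c|) (1 / (2 * K))).
  have h0 : 0 < Num.min (t / `|c|) (1 / (2 * K)).
    by rewrite lt_min !divr_gt0// mulr_gt0.
  split=> //.
    by rewrite normrM gtr0_norm// -ler_pdivlMr// ge_min lexx.
  by rewrite -ler_pdivlMr// ge_min -[_ / 2 / K]mulrA -invfM lexx orbT.
have [Hh hK] := HK _ hc.
have T := logpart_tangent H Hh Hx.
have c2 : 0 < c ^+ 2 by rewrite exprn_even_gt0 //= -normr_gt0.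
have hle : h * c * x <= h * c * x' + (h * c) ^+ 2 * K.
  move: E T hK; clear; move: (b (eta' + h * c)) (b eta) (b eta') => p q r; lra.
have hle' : (h * c ^+ 2) * 1 <= (h * c ^+ 2) * (h * K).
  have -> : h * c ^+ 2 * (h * K) = (h * c) ^+ 2 * K by ring.
  have -> : h * c ^+ 2 * 1 = h * c * x - h * c * x' by rewrite cE; ring.
  by move: hle; clear; lra.
move: hle'; rewrite (ler_pM2l (mulr_gt0 h0 c2)) => /le_trans/(_ hhK).
by rewrite leNgt ltr_pdivrMr// mul1r ltr1n.
Qed.

Lemma nat_of_meanP x : meanset rho x ->
  (natparam_set rho)° (nat_of_mean rho x) /\ fam_mean rho (nat_of_mean rho x) = x%:E.
Proof.
move=> [eta Hi Hx]; rewrite /nat_of_mean; case: xgetP => [y _ //|/(_ eta)].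
by case; split.
Qed.

Lemma KL_natE x eta' : meanset rho x -> natparam_set rho eta' ->
  KL_nat rho (nat_of_mean rho x) eta' =
  ((nat_of_mean rho x - eta') * x - b (nat_of_mean rho x) + b eta')%:E.
Proof.
move=> /nat_of_meanP[]; set eta := nat_of_mean rho x => Hi Hx H'.
have H : natparam_set rho eta by exact: interior_subset Hi.
have [_ E] := has_expect_affine (b eta' - b eta) (eta - eta') H Hx.
transitivity (b eta' - b eta + (eta - eta') * x)%:E; last first.
  by congr EFin; move: (b eta) (b eta') => p q; ring.
rewrite -E; apply: eq_integral => y _; congr EFin; rewrite mulrC; congr (_ * _).
rewrite /fam_density -expRN -expRD expRK.
by move: (b eta) (b eta') => p q; ring.
Qed.

Lemma kl_ge x y eta : natparam_set rho eta -> meanset rho y ->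
  (((eta - nat_of_mean rho y) * x - b eta + b (nat_of_mean rho y))%:E <= kl rho x y)%E.
Proof.
move=> H My; have [Hi Hy] := nat_of_meanP My.
rewrite /kl; case: ifPn => [/asboolP Mx|_].
  have [Hxi Hx] := nat_of_meanP Mx.
  have Hxn : natparam_set rho (nat_of_mean rho x) by exact: interior_subset Hxi.
  have Hyn := interior_subset Hi.
  rewrite (KL_natE Mx Hyn) lee_fin.
  have := logpart_tangent Hxn H Hx; clear.
  move: (nat_of_mean rho x) (nat_of_mean rho y) => p q.
  by move: (b p) (b q) (b eta) => u v z; lra.
by apply: ereal_sup_ubound; exists eta.
Qed.

Lemma kl_ge0 x y : meanset rho y -> (0 <= kl rho x y)%E.
Proof.
move=> My; have [Hi _] := nat_of_meanP My.
apply: le_trans (kl_ge x (interior_subset Hi) My).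
by rewrite subrr mul0r sub0r addNr.
Qed.

Lemma klE x y : meanset rho x -> meanset rho y -> fine (kl rho x y) =
  (nat_of_mean rho x - nat_of_mean rho y) * x - b (nat_of_mean rho x)
  + b (nat_of_mean rho y).
Proof.
move=> Mx My; rewrite /kl; case: ifPn => [_|/asboolP//].
by rewrite KL_natE//; have [/interior_subset] := nat_of_meanP My.
Qed.

Lemma kl_gt0 x y : meanset rho x -> meanset rho y -> x != y ->
  0 < fine (kl rho x y).
Proof.
move=> Mx My xy; rewrite klE//.
have [Hxi Hx] := nat_of_meanP Mx; have [Hyi Hy] := nat_of_meanP My.
have := logpart_tangent_lt Hxi Hyi Hx Hy xy; clear.
move: (nat_of_mean rho x) (nat_of_mean rho y) => p q.
by move: (b p) (b q) => u v; lra.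
Qed.

(* Monotonicity of [d(x, .)] away from [x], with the divergence replaced by
   its affine minorant at an arbitrary [eta]. *)
Lemma kl_ge_threshold x y theta eta : natparam_set rho eta ->
  meanset rho y -> meanset rho theta ->
  (y <= theta <= x) || (x <= theta <= y) ->
  (((eta - nat_of_mean rho theta) * x - b eta + b (nat_of_mean rho theta))%:E
    <= kl rho x y)%E.
Proof.
move=> H My Mt side; apply: le_trans (kl_ge x H My); rewrite lee_fin.
have [/interior_subset Hy Ey] := nat_of_meanP My.
have [/interior_subset Ht Et] := nat_of_meanP Mt.
have h1 := logpart_tangent Ht Hy Et; have h2 := logpart_tangent Hy Ht Ey.
have [yt|yt] := eqVneq y theta; first by rewrite yt.
move: h1 h2 side yt; clear.
move: (nat_of_mean rho y) (nat_of_mean rho theta) => p q.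
move: (b p) (b q) (b eta) => u v z h1 h2 side yt.
have h3 : 0 <= (p - q) * (y - theta) by lra.
have h4 : 0 <= (p - q) * (theta - x).
  move: side => /orP[/andP[a1 a2]|/andP[a1 a2]].
    have yt' : y - theta < 0 by rewrite subr_lt0 lt_neqAle yt.
    have pq : p - q <= 0 by rewrite -(ler_nM2r yt') mul0r.
    by rewrite mulr_le0// subr_le0.
  have yt' : 0 < y - theta by rewrite subr_gt0 lt_neqAle eq_sym yt.
  have pq : 0 <= p - q by rewrite -(pmulr_lge0 _ yt').
  by rewrite mulr_ge0// subr_ge0.
lra.
Qed.

End ExpFamilyFacts.

(** * Expectations of products of independent variables *)

Section ChangeOfVariables.
Context {R : realType}.

Import HBNNSimple.

Lemma integral_comp_approx d (T : measurableType d)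
    (m : {measure set T -> \bar R}) (G Z : T -> R) (f : R -> R)
    (mf : measurable_fun [set: R] (EFin \o f)) :
  measurable_fun [set: T] G -> measurable_fun [set: T] Z ->
  (forall x, 0 <= G x) -> (forall y, 0 <= f y) ->
  (\int[m]_x ((G x)%:E * (f (Z x))%:E) =
   limn (fun n => \sum_(y \in range (nnsfun_approx measurableT mf n)) y%:E *
     \int[m]_x ((G x)%:E *
       (\1_(nnsfun_approx measurableT mf n @^-1` [set y]) (Z x))%:E)))%E.
Proof.
move=> mG mZ G0 f0; set phi := nnsfun_approx measurableT mf.
transitivity (\int[m]_x limn (fun n => (G x)%:E * (phi n (Z x))%:E))%E.
  apply: eq_integral => x _; apply/esym/cvg_lim => //; apply: cvgeZl => //.
  by apply: (cvg_nnsfun_approx measurableT mf) => // y _; rewrite lee_fin.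
rewrite monotone_convergence//; last 3 first.
- move=> n; apply/measurable_EFinP/measurable_funM => //.
  exact: measurableT_comp.
- by move=> n x _; rewrite -EFinM lee_fin mulr_ge0.
- move=> x _ a b ab; rewrite -!EFinM lee_fin ler_wpM2l//.
  exact/lefP/nd_nnsfun_approx.
congr (limn _); apply/funext => n.
have m1 y : measurable_fun setT
    (fun x => (G x)%:E * (\1_(phi n @^-1` [set y]) (Z x))%:E)%E.
  apply/measurable_EFinP/measurable_funM => //; apply: measurableT_comp => //.
have g1 y x : (0 <= (G x)%:E * (\1_(phi n @^-1` [set y]) (Z x))%:E)%E.
  by rewrite -EFinM lee_fin mulr_ge0// indicE.
have g2 y x : (0 <= y%:E * ((G x)%:E * (\1_(phi n @^-1` [set y]) (Z x))%:E))%E.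
  by rewrite muleCA mule_ge0//; [rewrite lee_fin|exact: nnfun_muleindic_ge0].
transitivity (\int[m]_x (\sum_(y \in range (phi n))
    y%:E * ((G x)%:E * (\1_(phi n @^-1` [set y]) (Z x))%:E)))%E.
  apply: eq_integral => x _; rewrite fimfunE -fsumEFin// ge0_mule_fsumr.
    by apply: eq_fsbigr => y _; rewrite EFinM muleCA.
  by move=> y; rewrite EFinM nnfun_muleindic_ge0.
rewrite ge0_integral_fsum//; last by move=> y; apply: measurable_funeM.
apply: eq_fsbigr => y _; have [y0|y0] := leP 0 y.
  by rewrite ge0_integralZl.
have e0 x : \1_(phi n @^-1` [set y]) x = 0 :> R.
  by rewrite preimage_nnfun0// indic0.
by rewrite !integral0_eq ?mule0// => x _; rewrite e0 !mule0.
Qed.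

Lemma eq_integral_comp d1 (T1 : measurableType d1) d2 (T2 : measurableType d2)
    (m1 : {measure set T1 -> \bar R}) (m2 : {measure set T2 -> \bar R})
    (G1 Z1 : T1 -> R) (G2 Z2 : T2 -> R) (f : R -> R) :
  measurable_fun [set: T1] G1 -> measurable_fun [set: T1] Z1 ->
  (forall x, 0 <= G1 x) ->
  measurable_fun [set: T2] G2 -> measurable_fun [set: T2] Z2 ->
  (forall x, 0 <= G2 x) ->
  measurable_fun [set: R] f -> (forall y, 0 <= f y) ->
  (forall A, measurable A ->
     \int[m1]_x ((G1 x)%:E * (\1_A (Z1 x))%:E) =
     \int[m2]_x ((G2 x)%:E * (\1_A (Z2 x))%:E))%E ->
  (\int[m1]_x ((G1 x)%:E * (f (Z1 x))%:E) =
   \int[m2]_x ((G2 x)%:E * (f (Z2 x))%:E))%E.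
Proof.
move=> mG1 mZ1 G10 mG2 mZ2 G20 mf f0 H.
have mf' : measurable_fun [set: R] (EFin \o f) by exact/measurable_EFinP.
rewrite (integral_comp_approx m1 mf' mG1)// (integral_comp_approx m2 mf' mG2)//.
by congr (limn _); apply/funext => n; apply: eq_fsbigr => y _; rewrite H.
Qed.

Context {d : measure_display} {Omega : measurableType d}.
Variable P : probability Omega R.

Lemma indic_bigsetI (I T : Type) (s : seq I) (F : I -> set T) (x : T) :
  \1_(\big[setI/setT]_(i <- s) F i) x = \prod_(i <- s) \1_(F i) x :> R.
Proof.
elim: s => [|i s IH]; first by rewrite !big_nil indicT.
by rewrite !big_cons indicI /= IH.
Qed.

Lemma integral_indic_comp (Z : Omega -> R) A : measurable_fun setT Z ->
  measurable A -> (\int[P]_om (\1_A (Z om))%:E = P (Z @^-1` A))%E.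
Proof.
move=> mZ mA; have mZA : measurable (Z @^-1` A).
  by rewrite -[_ @^-1` _]setTI; exact: mZ.
have := integral_indic P measurableT mZA; rewrite setIT => <-.
exact: eq_integral.
Qed.

Lemma expectation_prod (I : choiceType) (J : set I) (Z : I -> Omega -> R)
    (s : seq I) (f : I -> R -> R) (c : I -> R) :
  mutually_independent P J Z -> uniq s -> (forall i, i \in s -> J i) ->
  (forall i, measurable_fun setT (Z i)) ->
  (forall i, measurable_fun setT (f i)) -> (forall i y, 0 <= f i y) ->
  (forall i, i \in s -> \int[P]_om (f i (Z i om))%:E = (c i)%:E)%E ->
  (\int[P]_om (\prod_(i <- s) f i (Z i om))%:E = (\prod_(i <- s) c i)%:E)%E.
Proof.
move=> ind us sJ mZ.
(* The coordinates outside [r] are indicators; independence gives the case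
   [r = [::]], and each step frees one coordinate. *)
suff H (r : seq I) : forall (f : I -> R -> R) (c : I -> R) (A : I -> set R),
    (forall i, measurable (A i)) ->
    (forall i, i \in s -> i \notin r -> f i = \1_(A i)) ->
    (forall i, measurable_fun setT (f i)) -> (forall i y, 0 <= f i y) ->
    (forall i, i \in s -> \int[P]_om (f i (Z i om))%:E = (c i)%:E)%E ->
    (\int[P]_om (\prod_(i <- s) f i (Z i om))%:E = (\prod_(i <- s) c i)%:E)%E.
  by move=> mf f0 fc; apply: (H s f c (fun=> setT)) => // i ->.
elim: r => [|j r IH] {}f {}c A mA fA mf f0 fc.
  have cE i : i \in s -> (c i)%:E = P (Z i @^-1` A i).
    by move=> si; rewrite -fc// fA// integral_indic_comp.
  rewrite -prodEFin (eq_big_seq _ cE) -ind//.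
  have mcap : measurable (\bigcap_(i in [set` s]) Z i @^-1` A i).
    rewrite bigcap_seq; apply: bigsetI_measurable => i _.
    by rewrite -[_ @^-1` _]setTI; exact: mZ.
  have := integral_indic P measurableT mcap; rewrite setIT => <-.
  apply: eq_integral => om _; congr EFin; rewrite bigcap_seq indic_bigsetI.
  by apply: eq_big_seq => i si; rewrite fA.
have [js|js] := boolP (j \in s); last first.
  apply: (IH f c A) => // i si ir; apply: fA => //.
  by rewrite inE negb_or ir andbT; apply: contraNneq js => <-.
pose G om := \prod_(i <- rem j s) f i (Z i om).
pose C := \prod_(i <- rem j s) c i.
have c0 i : i \in s -> 0 <= c i.
  by move=> si; rewrite -lee_fin -fc// integral_ge0// => om _; rewrite lee_fin.
have C0 : 0 <= C.
  rewrite /C big_seq_cond prodr_ge0// => i; rewrite andbT => /mem_rem; exact: c0.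
rewrite (big_rem j)//= -/C.
under eq_integral do rewrite (big_rem j)//= -/(G _) mulrC EFinM.
rewrite (@eq_integral_comp _ _ _ _ P P G (Z j) (fun=> C) (Z j) (f j))//.
- rewrite ge0_integralZl//.
  + by rewrite fc// -EFinM mulrC.
  + by apply/measurable_EFinP; exact: measurableT_comp.
  + by move=> om _; rewrite lee_fin.
- by apply: measurable_prod => i _; exact: measurableT_comp.
- by move=> om; apply: prodr_ge0.
move=> B mB.
have mZB : measurable (Z j @^-1` B) by rewrite -[_ @^-1` _]setTI; exact: mZ.
have -> : (\int[P]_om (C%:E * (\1_B (Z j om))%:E) = C%:E * P (Z j @^-1` B))%E.
  rewrite ge0_integralZl//; first by rewrite integral_indic_comp.
    by apply/measurable_EFinP; apply: measurableT_comp.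
pose f' i := if i == j then \1_B else f i.
pose c' i := if i == j then fine (P (Z j @^-1` B)) else c i.
transitivity (\int[P]_om (\prod_(i <- s) f' i (Z i om))%:E)%E.
  apply: eq_integral => om _; rewrite (big_rem j)//= {1}/f' eqxx mulrC -EFinM.
  congr ((_ * _)%:E); apply: eq_big_seq => i.
  by rewrite mem_rem_uniq// inE => /andP[/negbTE ij _]; rewrite /f' ij.
rewrite (IH f' c' (fun i => if i == j then B else A i)).
- rewrite (big_rem j)//= {1}/c' eqxx EFinM fineK ?fin_num_measure// muleC.
  congr (_%:E * _)%E; apply: eq_big_seq => i.
  by rewrite mem_rem_uniq// inE => /andP[/negbTE ij _]; rewrite /c' ij.
- by move=> i; case: ifP.
- move=> i si ir; rewrite /f'; case: ifPn => // ij; apply: fA => //.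
  by rewrite inE negb_or ij.
- by move=> i; rewrite /f'; case: ifP.
- by move=> i y; rewrite /f'; case: ifP => // _; rewrite indicE.
- move=> i si; rewrite /f' /c'; case: ifPn => [/eqP ->|ij]; last exact: fc.
  by rewrite integral_indic_comp// fineK// fin_num_measure.
Qed.

End ChangeOfVariables.

(** * The strong law of large numbers under exponential moments *)

Section StrongLaw.
Context {R : realType} {d : measure_display} {Omega : measurableType d}.
Variable P : probability Omega R.

Lemma borel_cantelli_geometric (F : nat -> set Omega) (r : R) :
  (forall n, measurable (F n)) -> 0 <= r < 1 ->
  (forall n, P (F n) <= (r ^+ n)%:E)%E ->
  \forall om \ae P, \forall n \near \oo, ~ F n om.
Proof.
move=> mF /andP[r0 r1] PF.
exists (lim_sup_set F); split.
- apply: bigcap_measurable => // n _; exact: bigcup_measurable.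
- apply: lim_sup_set_cvg0 => //.
  apply: (@le_lt_trans _ _ (\sum_(n <oo) (r ^+ n)%:E)%E).
    by apply: lee_nneseries => // n _; exact: PF.
  have /cvg_geometric_series : `|r| < 1 by rewrite ger0_norm.
  move=> /(_ 1) cv.
  have -> : (\sum_(n <oo) (r ^+ n)%:E)%E = (1 * (1 - r)^-1)%:E; last exact: ltry.
  apply/cvg_lim => //; apply: cvg_EFin; first by apply: nearW => n; rewrite sumEFin.
  apply: cvg_trans cv; apply: near_eq_cvg; apply: nearW => n /=.
  by rewrite sumEFin /= /series /=; apply: eq_bigr => i _; rewrite /geometric /= mul1r.
- move=> om /= H n _; apply: contrapT => nF; apply: H.
  exists n => // k /= nk Fk; apply: nF; by exists k.
Qed.

Context {I : choiceType}.
Variables (J : set I) (W : I -> Omega -> R) (h : nat -> I).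
Hypotheses (ind : mutually_independent P J W) (hJ : forall k, J (h k)).
Hypotheses (h_inj : injective h) (mW : forall i, measurable_fun setT (W i)).
Variables (x t K : R) (M : R -> R).
Hypotheses (t0 : 0 < t) (K0 : 0 < K).
Hypothesis mgfE : forall (s : R) k, `|s| <= t ->
  (\int[P]_om (expR (s * (W (h k) om - x)))%:E = (M s)%:E)%E.
Hypothesis mgf_le : forall s, `|s| <= t -> M s <= expR (s ^+ 2 * K).

Let S n om := \sum_(k < n) (W (h k) om - x).

Lemma measurable_centered_sum n : measurable_fun setT (S n).
Proof.
by apply: measurable_sum => k; apply: measurable_funB.
Qed.

Lemma chernoff_mean (sg : bool) (e : R) : 0 < e ->
  exists2 r, 0 <= r < 1 & forall n,
  (P [set om | (n%:R * e <= (-1) ^+ sg * S n om)%R] <= (r ^+ n)%:E)%E.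
Proof.
move=> e0; have [u [u0 ut uK]] : exists u, [/\ 0 < u, u <= t & u * K <= e / 2].
  exists (Num.min t (e / (2 * K))); split; rewrite ?ge_min ?lexx//.
    by rewrite lt_min t0 divr_gt0// mulr_gt0.
  by rewrite -ler_pdivlMr// ge_min -[_ / 2 / K]mulrA -invfM lexx orbT.
pose s := (-1) ^+ sg * u.
have s2 : s ^+ 2 = u ^+ 2 by rewrite /s exprMn sqrr_sign mul1r.
have st : `|s| <= t by rewrite /s normrM normr_sign mul1r gtr0_norm.
exists (expR (- (u * e)) * M s).
  have M0 : 0 <= M s.
    by rewrite -lee_fin -(mgfE 0%N st) integral_ge0// => om _; rewrite lee_fin expR_ge0.
  rewrite mulr_ge0 ?expR_ge0//=.
  apply: (@le_lt_trans _ _ (expR (- (u * e) + u ^+ 2 * K))).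
    by rewrite expRD ler_pM2l ?expR_gt0// -s2 mgf_le.
  rewrite -expR0 ltr_expR; have := mulr_gt0 u0 e0.
  have := ler_wpM2l (ltW u0) uK; lra.
move=> n; have mS := measurable_centered_sum n.
set A := [set om | _].
have mA : measurable A.
  rewrite [A](_ : _ = setT `&` (fun om => (-1) ^+ sg * S n om) @^-1` `[n%:R * e, +oo[).
    by apply: measurable_funM => //; exact: measurable_itv.
  by apply/seteqP; split=> om /=; rewrite in_itv /= andbT => // -[].
have := integral_indic P measurableT mA; rewrite setIT => <-.
apply: (@le_trans _ _ (\int[P]_om ((expR (- (u * e)) ^+ n)%:E *
   (\prod_(i <- map h (index_iota 0 n)) expR (s * (W i om - x)))%:E))%E).
  apply: ge0_le_integral => //.
  - exact/measurable_EFinP/measurable_indic.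
  - apply: measurable_funeM; apply/measurable_EFinP.
    apply: measurable_prod => i _; apply: measurableT_comp => //.
    by apply: measurable_funM => //; exact: measurable_funB.
  - move=> om _; rewrite -EFinM lee_fin big_map big_mkord -expR_sum.
    rewrite -expRM_natl -expRD indicE;
    case: (boolP (om \in A)) => [/set_mem /= Aom|_]; last exact: expR_ge0.
    rewrite -[leLHS]expR0 ler_expR -mulr_sumr -/(S n om) /s mulrN addrC subr_ge0.
    by rewrite mulrCA mulrAC mulrC ler_wpM2r// ltW.
rewrite ge0_integralZl//; last 2 first.
- apply/measurable_EFinP; apply: measurable_prod => i _; apply: measurableT_comp => //.
  by apply: measurable_funM => //; exact: measurable_funB.
- by move=> om _; rewrite lee_fin prodr_ge0// => i _; exact: expR_ge0.
rewrite (@expectation_prod _ _ _ P _ J W _ (fun _ y => expR (s * (y - x))) (fun=> M s))//.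
- by rewrite big_const_seq count_predT size_map size_iota subn0 iter_mulr_1 exprMn EFinM.
- by rewrite map_inj_uniq// iota_uniq.
- by move=> i /mapP[k _ ->].
- move=> i; apply: measurableT_comp => //; apply: measurable_funM => //.
  exact: measurable_funB.
- by move=> i /mapP[k _ ->]; exact: mgfE.
Qed.

Lemma strong_law :
  \forall om \ae P, (\sum_(k < n) W (h k) om) / n%:R @[n --> \oo] --> x.
Proof.
have H (sg : bool) (m : nat) : \forall om \ae P, \forall n \near \oo,
    (-1) ^+ sg * S n om < n%:R * m.+1%:R^-1.
  have [|r r01 Pr] := @chernoff_mean sg (m.+1%:R^-1); first by rewrite invr_gt0.
  have BC : forall n, measurable [set om | n%:R * m.+1%:R^-1 <= (-1) ^+ sg * S n om].
    move=> n; have mS := measurable_centered_sum n; rewrite (_ : [set om | _] =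
      setT `&` (fun om => (-1) ^+ sg * S n om) @^-1` `[n%:R * m.+1%:R^-1, +oo[).
      by apply: measurable_funM => //; exact: measurable_itv.
    by apply/seteqP; split=> om /=; rewrite in_itv /= andbT => // -[].
  apply: filterS (borel_cantelli_geometric BC r01 Pr) => om.
  by apply: filterS => n /= /negP; rewrite -ltNge.
have := ae_foralln (H true); have := ae_foralln (H false).
apply: filterS2 => om Hp Hn; apply/cvgrPdist_le => e e0.
have [m me] : exists m : nat, m.+1%:R^-1 <= e.
  exists (Num.truncn e^-1); rewrite invf_ple ?posrE//.
  exact/ltW/truncnS_gt.
move: (Hp m) (Hn m) => {}Hp {}Hn.
near=> n.
have n0 : 0 < n%:R :> R by rewrite ltr0n; near: n; exists 1%N.
have -> : x - (\sum_(k < n) W (h k) om) / n%:R = - (S n om / n%:R).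
  rewrite /S sumrB sumr_const card_ord -[x *+ n]mulr_natr mulrBl mulfK ?gt_eqF//.
  by rewrite opprB.
rewrite normrN; apply: le_trans me.
have hp : (-1) ^+ false * S n om < n%:R * m.+1%:R^-1 by near: n.
have hn : (-1) ^+ true * S n om < n%:R * m.+1%:R^-1 by near: n.
rewrite expr0 mul1r in hp; rewrite expr1 mulN1r in hn.
rewrite normrM [`|n%:R^-1|]gtr0_norm ?invr_gt0// ler_pdivrMr// mulrC.
by apply: ltW; rewrite ltr_norml hp andbT ltrNl.
Unshelve. all: by end_near. Qed.

End StrongLaw.

(** * Growth of the GLR statistic and the stopping time *)

Section FamilyRewards.
Context {R : realType} {d : measure_display} {Omega : measurableType d}.
Variables (P : probability Omega R) (rho : {measure set R -> \bar R}).

Lemma fam_law_neq0 eta (y : Omega -> R) :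
  P (y @^-1` setT) = fam_law rho eta setT -> rho setT != 0%E.
Proof.
move=> H; apply/eqP => r0; move: H; rewrite preimage_setT probability_setT /fam_law.
have mf : measurable_fun setT (EFin \o fam_density rho eta).
  by apply/measurable_EFinP; exact: measurable_density.
have := integral_abs_eq0 measurableT mf r0.
under eq_integral do rewrite gee0_abs ?lee_fin ?expR_ge0//.
by move=> -> /eqP; rewrite eqe oner_eq0.
Qed.

Lemma expectation_fam_law eta (y : Omega -> R) (g : R -> R) r :
  measurable_fun setT y ->
  (forall A, measurable A -> P (y @^-1` A) = fam_law rho eta A) ->
  measurable_fun setT g -> (forall z, 0 <= g z) ->
  has_expect rho eta g r -> (\int[P]_om (g (y om))%:E = r%:E)%E.
Proof.
move=> my law mg g0 [_ <-].
transitivity (\int[P]_om (1%:E * (g (y om))%:E))%E.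
  by apply: eq_integral => om _; rewrite mul1e.
rewrite (@eq_integral_comp _ _ _ _ _ P rho (fun=> 1) y (fam_density rho eta) id g)//.
- by apply: eq_integral => z _; rewrite mulrC EFinM.
- exact: measurable_density.
- by move=> z; exact: expR_ge0.
move=> A mA; under eq_integral do rewrite mul1e.
rewrite integral_indic_comp// law// /fam_law [LHS]integral_mkcond.
apply: eq_integral => z _; rewrite patchE indicE.
by case: ifP => _; rewrite ?mule1 ?mule0.
Qed.

Hypothesis rho0 : rho setT != 0%E.

Lemma fam_strong_law (I : choiceType) (J : set I) (W : I -> Omega -> R)
    (h : nat -> I) (x : R) :
  mutually_independent P J W -> (forall k, J (h k)) -> injective h ->
  (forall i, measurable_fun setT (W i)) -> meanset rho x ->
  (forall k A, measurable A ->
     P (W (h k) @^-1` A) = fam_law rho (nat_of_mean rho x) A) ->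
  \forall om \ae P, (\sum_(k < n) W (h k) om) / n%:R @[n --> \oo] --> x.
Proof.
move=> ind hJ hinj mW Mx law; have [Hi Hx] := nat_of_meanP Mx.
have [t [K [t0 K0 HK]]] := mgf_subgaussian rho0 Hi Hx.
set eta := nat_of_mean rho x in law Hi Hx HK *.
pose M s := expR (- (s * x)) * expR (logpart rho (eta + s) - logpart rho eta).
apply: (strong_law ind hJ hinj mW t0 K0 (M := M)) => s; last first.
  move=> st; have [_] := HK s st; rewrite /M -expRD ler_expR; clear; lra.
move=> k st; have [Hs _] := HK s st.
apply: (expectation_fam_law (g := fun z => expR (s * (z - x))) (mW _) (law k)).
- apply: measurableT_comp => //; apply: measurable_funM => //.
  exact: measurable_funB.
- by move=> z; exact: expR_ge0.
have := has_expectZ (expR (- (s * x))) (has_expect_expR rho0 Hs).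
by congr has_expect; apply/funext => z; rewrite -expRD; congr expR; ring.
Qed.

End FamilyRewards.

Lemma near_all_seq (T : eqType) (s : seq T) (Q : T -> nat -> Prop) :
  (forall l, l \in s -> \forall t \near \oo, Q l t) ->
  \forall t \near \oo, forall l, l \in s -> Q l t.
Proof.
elim: s => [|l s IH] H; first by apply: nearW.
have Hl := H l (mem_head _ _).
have /IH Hs : forall l, l \in s -> \forall t \near \oo, Q l t.
  by move=> l' ls; apply: H; rewrite inE ls orbT.
by apply: filterS2 Hl Hs => t Ql Qs l'; rewrite inE => /predU1P[->//|]; exact: Qs.
Qed.

Section Stopping.
Context {R : realType}.
Variables (rho : {measure set R -> \bar R}) (tr : tree) (theta : R) (mu : nat -> R).
Hypothesis (rho0 : rho setT != 0%E).
Hypotheses (Htheta : meanset rho theta).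
Hypothesis Hmu : forall l, l \in leaves tr -> meanset rho (mu l).
Hypothesis HV : value mu tr != theta.
Variable w : nat -> R.
Local Notation a := (win theta mu tr).
Local Notation D := (dval rho theta mu a tr).
Hypothesis Hw : wrel rho theta mu a w tr.
Context {d : measure_display} {Omega : measurableType d}.
Variables (Y : nat -> nat -> Omega -> R) (I : nat -> Omega -> nat) (om : Omega).

Lemma dval_root_gt0 : 0 < D.
Proof.
apply: dval_gt0; last first.
  rewrite /strict_win /win; case: (leP theta (value mu tr)) => [h|//].
  by rewrite lt_def HV h.
by move=> l /Hmu Ml lt; exact: kl_gt0.
Qed.

Hypothesis HN : forall l, l \in leaves tr ->
  (Npulls I l t om)%:R / t%:R @[t --> \oo] --> w l.
Hypothesis Hemp : forall l, l \in leaves tr -> 0 < w l ->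
  emp_mean Y I l t om @[t --> \oo] --> mu l.

Lemma glr_stat_ge D' : D' < D ->
  \forall t \near \oo, ((D' * t%:R)%:E <= glr_stat rho theta tr Y I t om)%E.
Proof.
move=> DD; have [s [sP sW]] := wrel_strategy Hw dval_root_gt0.
pose g l x := (nat_of_mean rho (mu l) - nat_of_mean rho theta) * x
  - logpart rho (nat_of_mean rho (mu l)) + logpart rho (nat_of_mean rho theta).
pose Q l t := [/\ (theta <= emp_mean Y I l t om) = a,
   emp_mean Y I l t om != theta &
   D' * t%:R <= (Npulls I l t om)%:R * g l (emp_mean Y I l t om)].
have HQ l : l \in s -> \forall t \near \oo, Q l t.
  move=> /sP[ll wl side dl wd]; have Ml := Hmu ll.
  have ml : mu l != theta.
    apply: contraTneq dl => mlt.
    by rewrite mlt klE// subrr mul0r sub0r addNr ltxx.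
  have cE := Hemp ll wl; have cN := HN ll.
  have cG : (Npulls I l t om)%:R / t%:R * g l (emp_mean Y I l t om) @[t --> \oo] --> D.
    rewrite -wd klE//; apply: cvgM => //; apply: cvgD; last exact: cvg_cst.
    by apply: cvgB; [apply: cvgM; [exact: cvg_cst|exact: cE]|exact: cvg_cst].
  have h1 : \forall t \near \oo,
      D' < (Npulls I l t om)%:R / t%:R * g l (emp_mean Y I l t om).
    exact: cvgr_gt cG _ DD.
  have h2 : \forall t \near \oo, (theta <= emp_mean Y I l t om) = a /\
      emp_mean Y I l t om != theta.
    move: side; rewrite /on_side; case: (a) => /=; rewrite ?orbF => side.
      have lt : theta < mu l by rewrite lt_neqAle eq_sym ml.
      by apply: filterS (cvgr_gt _ cE _ lt) => t /= H; rewrite ltW// gt_eqF.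
    by apply: filterS (cvgr_lt _ cE _ side) => t /= H; rewrite leNgt H lt_eqF.
  have h3 : \forall t \near \oo, (0 < t)%N by exists 1%N.
  apply: filterS3 h1 h2 h3 => t H1 [H2 H3] t0; split=> //.
  have t0' : 0 < t%:R :> R by rewrite ltr0n.
  by move: (ltW H1); rewrite mulrAC ler_pdivlMr.
apply: filterS (near_all_seq HQ) => t Qt.
apply: le_ereal_inf_tmp => _ [lam [Mlam]] /= winlam <-.
have wa : win theta (fun l => emp_mean Y I l t om) tr = a.
  by apply: sW => l ls; have [] := Qt l ls.
rewrite wa in winlam.
have [l ls lla] : exists2 l, l \in s & (theta <= lam l) != a.
  case: (boolP (all (fun l => (theta <= lam l) == a) s)) => [/allP H|/allPn//].
  by rewrite sW ?eqxx// in winlam => l /H /eqP.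
have [ll _ _ _ _] := sP l ls; have [H1 H2 H3] := Qt l ls.
rewrite (big_rem l)//=; apply: (@le_trans _ _ ((Npulls I l t om)%:R%:E *
    kl rho (emp_mean Y I l t om) (lam l))%E); last first.
  rewrite leeDl// big_seq; apply: sume_ge0 => i /mem_rem il.
  by rewrite mule_ge0 ?lee_fin// kl_ge0//; exact: Mlam.
apply: (@le_trans _ _ ((Npulls I l t om)%:R%:E * (g l (emp_mean Y I l t om))%:E)%E).
  by rewrite -EFinM lee_fin.
apply: lee_wpmul2l; first by rewrite lee_fin.
have [Hli _] := nat_of_meanP (Hmu ll).
apply: kl_ge_threshold => //; [exact: interior_subset|exact: Mlam|].
move: lla H1; case: (a) => /=.
  by rewrite eqb_id -ltNge => /ltW -> ->.
by rewrite eqbF_neg negbK => -> /negbT; rewrite -ltNge => /ltW ->; rewrite orbT.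
Qed.

Lemma stop_time_le (D' k C : R) (T0 : nat) (delta : R) :
  0 <= C -> 0 <= k -> k < D' -> 0 < delta < 1 ->
  (forall t, (T0 <= t)%N -> ((D' * t%:R)%:E <= glr_stat rho theta tr Y I t om)%E) ->
  (forall t, beta_thr tr I t om delta <= k * t%:R + (1 + k) * ln (1 / delta) + C) ->
  (stop_time rho theta tr Y I delta om <=
   (((1 + k) * ln (1 / delta) + C) / (D' - k) + T0.+1%:R)%:E)%E.
Proof.
move=> C0 k0 kD /andP[d0 d1] Hglr Hbeta.
have L0 : 0 <= ln (1 / delta) by rewrite div1r lnV ?posrE// oppr_ge0 ln_le0// ltW.
set L := ln (1 / delta) in L0 Hbeta *.
have kD0 : 0 < D' - k by rewrite subr_gt0.
set u := ((1 + k) * L + C) / (D' - k).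
have u0 : 0 <= u.
  apply: divr_ge0; last exact: ltW.
  by apply: addr_ge0 => //; apply: mulr_ge0 => //; exact: addr_ge0.
pose t := ((Num.truncn u).+1 + T0)%N.
have ut : u <= t%:R.
  by apply: (le_trans (ltW (Num.Theory.truncnS_gt u))); rewrite ler_nat leq_addr.
apply: (@le_trans _ _ (t%:R)%:E).
  apply: ereal_inf_lbound; exists t => //=.
  apply: le_trans (Hglr t (leq_addl _ _)); rewrite lee_fin.
  apply: (le_trans (Hbeta t)).
  move: ut; rewrite /u ler_pdivrMr// => ut.
  by rewrite -addrA -lerBrDl -mulrBl [leRHS]mulrC.
rewrite lee_fin /t addSnnS natrD lerD2r.
by rewrite Num.Theory.truncn_le.
Qed.

Lemma stop_time_lty (delta : R) : 0 < delta < 1 ->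
  (stop_time rho theta tr Y I delta om < +oo)%E.
Proof.
move=> dd; have D0 := dval_root_gt0.
have [T0 _ HT] : \forall t \near \oo,
    ((D / 2 * t%:R)%:E <= glr_stat rho theta tr Y I t om)%E.
  by apply: glr_stat_ge; rewrite ltr_pdivrMr// mulr_natr mulr2n ltrDl.
have k0 : 0 < D / 4 by rewrite divr_gt0.
have [C C0 HC] := beta_thr_le tr I k0.
have kD : D / 4 < D / 2 by rewrite ltr_pM2l// ltf_pV2 ?posrE// ltr_nat.
by apply: le_lt_trans (stop_time_le C0 (ltW k0) kD dd HT (fun t => HC t om delta dd)) _;
  rewrite ltry.
Qed.

Lemma stop_time_limsup :
  (limf_esup (fun delta : R =>
     stop_time rho theta tr Y I delta om * (ln (1 / delta))^-1%:E) (0^'+)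
   <= (D^-1)%:E)%E.
Proof.
have D0 := dval_root_gt0; apply/lee_addgt0Pr => e e0.
pose q := D^-1 + e / 2.
have DV0 : 0 < D^-1 by rewrite invr_gt0.
have q0 : 0 < q by rewrite addr_gt0// divr_gt0.
have q1 : 0 < 1 + 2 * q by rewrite addr_gt0// mulr_gt0.
have [k k0 kE] : exists2 k, 0 < k & (1 + k) <= q * (D - k - k).
  exists (e * D / 2 / (1 + 2 * q)); first by rewrite !divr_gt0// mulr_gt0.
  set k := _ / (1 + 2 * q).
  have : k * (1 + 2 * q) = e * D / 2 by rewrite mulfVK// gt_eqF.
  have : q * D = 1 + e * D / 2 by rewrite mulrDl mulVf ?gt_eqF// mulrAC.
  move: (D) (k) (q) => y z v h1 h2; lra.
have Dk0 : 0 < D - k - k.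
  by rewrite -(pmulr_rgt0 _ q0) (lt_le_trans _ kE)// addr_gt0.
have DD : D - k < D by rewrite ltrBlDr ltrDl.
have [T0 _ HT] := glr_stat_ge DD.
have [C C0 HC] := beta_thr_le tr I k0.
have kD : k < D - k by rewrite -subr_gt0.
pose C' := C / (D - k - k) + T0.+1%:R.
have C'0 : 0 <= C' by rewrite addr_ge0// divr_ge0// ltW.
pose B := 2 * C' / e + 1.
have B0 : 0 < B by rewrite ltr_pwDr// divr_ge0 ?mulr_ge0// ltW.
rewrite limf_esupE; apply: ge_ereal_inf.
pose V : set R := [set delta | 0 < delta < expR (- B)].
exists (ereal_sup ((fun delta : R => (stop_time rho theta tr Y I delta om
  * (ln (1 / delta))^-1%:E)%E) @` V)).
  exists V => //; rewrite /V /=.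
  near=> delta; apply/andP; split; near: delta; first exact: nbhs_right_gt.
  by apply: nbhs_right_lt; exact: expR_gt0.
apply: ge_ereal_sup => _ [delta /= /andP[d0 dB] <-].
have d1 : delta < 1 by rewrite (lt_trans dB)// -expR0 ltr_expR oppr_lt0.
have dd : 0 < delta < 1 by rewrite d0.
have LB : B < ln (1 / delta).
  by rewrite div1r lnV ?posrE// ltrNr -(expRK (- B)) ltr_ln ?posrE ?expR_gt0.
have L0 : 0 < ln (1 / delta) by apply: lt_trans LB.
have := stop_time_le C0 (ltW k0) kD dd HT (fun t => HC t om delta dd).
move=> /(lee_wpmul2r (x := (ln (1 / delta))^-1%:E)).
rewrite lee_fin invr_ge0 => /(_ (ltW L0)) /le_trans; apply.
rewrite -EFinM -EFinD lee_fin ler_pdivrMr//.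
set L := ln (1 / delta) in LB L0 *.
rewrite mulrDl -addrA -/C' mulrAC.
have h1 : (1 + k) / (D - k - k) * L <= q * L.
  by rewrite ler_pM2r// ler_pdivrMr.
have h2 : C' <= e / 2 * L.
  have -> : C' = e / 2 * (2 * C' / e).
    by move: (C') => z; field; rewrite gt_eqF.
  rewrite ler_pM2l ?divr_gt0//; apply: le_trans (ltW LB).
  by rewrite /B lerDl.
have -> : (D^-1 + e) * L = q * L + e / 2 * L by rewrite /q; field; rewrite gt_eqF.
exact: lerD.
Unshelve. all: by end_near. Qed.

End Stopping.

Lemma emp_mean_cvg (R : realType) (d : measure_display) (Omega : measurableType d)
    (Y : nat -> nat -> Omega -> R) (I : nat -> Omega -> nat) (l : nat)
    (om : Omega) (x w : R) : 0 < w ->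
  (Npulls I l t om)%:R / t%:R @[t --> \oo] --> w ->
  (\sum_(k < n) Y l k om) / n%:R @[n --> \oo] --> x ->
  emp_mean Y I l t om @[t --> \oo] --> x.
Proof.
move=> w0 HN HY.
have Noo : Npulls I l t om @[t --> \oo] --> \oo.
  apply/cvgnyPge => A.
  have w2 : w / 2 < w by rewrite ltr_pdivrMr// mulr_natr mulr2n ltrDl.
  near=> t.
  have t0 : 0 < t%:R :> R by rewrite ltr0n; near: t; exists 1%N.
  have h : w / 2 < (Npulls I l t om)%:R / t%:R by near: t; exact: cvgr_gt HN _ w2.
  rewrite -(ler_nat R); rewrite ltr_pdivlMr// in h; apply: le_trans (ltW h).
  rewrite -ler_pdivrMl ?divr_gt0//; near: t.
  exact: nbhs_infty_ger.
have -> : (fun t => emp_mean Y I l t om) =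
    (fun n => (\sum_(k < n) Y l k om) / n%:R) \o (fun t => Npulls I l t om).
  apply/funext => t; rewrite /emp_mean /=; case: eqP => // ->.
  by rewrite big_ord0 mul0r.
exact: cvg_comp Noo HY.
Unshelve. all: by end_near. Qed.

Theorem theorem4
  (R : realType) (rho : {measure set R -> \bar R})
  (tr : tree) (theta : R) (mu : nat -> R)
  (Huniq : uniq (leaves tr))
  (Htheta : meanset rho theta)
  (Hmu : forall l, l \in leaves tr -> meanset rho (mu l))
  (HV : value mu tr != theta)
  (w : nat -> R) (Hw : wrel rho theta mu (win theta mu tr) w tr)
  (d : measure_display) (Omega : measurableType d) (P : probability Omega R)
  (Y : nat -> nat -> Omega -> R)
  (HYmeas : forall l k, measurable_fun setT (Y l k))
  (HYlaw : forall l k, l \in leaves tr -> forall A : set R, measurable A ->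
             P (Y l k @^-1` A) = fam_law rho (nat_of_mean rho (mu l)) A)
  (HYind : mutually_independent P
             [set lk : nat * nat | lk.1 \in leaves tr]
             (fun lk => Y lk.1 lk.2))
  (I : nat -> Omega -> nat)
  (HIleaf : forall t om, I t om \in leaves tr)
  (HImeas : forall t l, measurable [set om | I t om = l])
  (Hconv : \forall om \ae P, forall l, l \in leaves tr ->
             (Npulls I l t om)%:R / t%:R @[t --> \oo] --> w l) :
  (forall delta : R, 0 < delta < 1 ->
     \forall om \ae P, (stop_time rho theta tr Y I delta om < +oo)%E)
  /\
  (\forall om \ae P,
     (limf_esup (fun delta : R =>
                   stop_time rho theta tr Y I delta om * (ln (1 / delta))^-1%:E)
                (0^'+)
      <= ((dval rho theta mu (win theta mu tr) tr)^-1)%:E)%E).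
Proof.
have rho0 : rho setT != 0%E.
  have [om _] : [set: Omega] !=set0.
    apply/set0P/negP => /eqP T0; have := @probability_setT _ _ _ P.
    by rewrite T0 measure0 => /eqP; rewrite eqe eq_sym oner_eq0.
  by apply: (fam_law_neq0 (HYlaw _ 0%N (HIleaf 0%N om) setT _)).
have Hlln : \forall om \ae P, forall l, l \in leaves tr ->
    (\sum_(k < n) Y l k om) / n%:R @[n --> \oo] --> mu l.
  apply: ae_foralln => l; have [ll|ll] := boolP (l \in leaves tr); last first.
    exact: aeW.
  have law k A : measurable A ->
      P (Y l k @^-1` A) = fam_law rho (nat_of_mean rho (mu l)) A.
    exact: HYlaw.
  have inj : injective (fun k : nat => (l, k)) by move=> k k' [].
  have hJ (k : nat) : [set lk : nat * nat | lk.1 \in leaves tr] (l, k) by [].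
  have := fam_strong_law rho0 HYind hJ inj (fun i => HYmeas i.1 i.2) (Hmu l ll) law.
  by apply: filterS => om.
have Hgood : \forall om \ae P,
    (forall l, l \in leaves tr -> (Npulls I l t om)%:R / t%:R @[t --> \oo] --> w l) /\
    (forall l, l \in leaves tr -> 0 < w l ->
       emp_mean Y I l t om @[t --> \oo] --> mu l).
  apply: filterS2 Hconv Hlln => om HN HY; split=> // l ll wl.
  exact: emp_mean_cvg wl (HN l ll) (HY l ll).
split=> [delta dd|]; apply: filterS Hgood => om [HN Hemp].
- exact: (stop_time_lty rho0 Htheta Hmu HV Hw HN Hemp dd).
- exact: (stop_time_limsup rho0 Htheta Hmu HV Hw HN Hemp).
Qed.
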